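(* Let $X$ be an infinite-dimensional operator space, and let $Z$ be a Dvoretzky space for $X$. Let $Y$ be a homogeneous Hilbertian operator space such that $\kappa_n(Y)\gtrsim n^{c}$ for some $c\in[0,1/2]$. If there is a completely Lipschitz in small scale embedding $B_X\to Y$, then $\kappa_n(Z)\gtrsim n^{c/(1+2c)}$.
   Context: Operator spaces are complex: an operator space is a closed linear subspace $X\subseteq \mathcal B(H)$, $H$ a complex Hilbert space, with $\mathrm M_n(X)$ normed through $\mathrm M_n(X)\subseteq \mathrm M_n(\mathcal B(H))\cong\mathcal B(H^{\oplus n})$. $B_E$ is the closed unit ball of $E$. For a map $f$, $f_n([x_{ij}])=[f(x_{ij})]$; for linear $u$, $\|u\|_{\rm cb}=\sup_n\|u_n\|$. An operator space $X$ is Hilbertian if it is linearly isometric to a Hilbert space, and homogeneous if $\|u\|_{\rm cb}=\|u\|$ for every bounded linear $u\colon X\to X$. For a homogeneous Hilbertian operator space $X$ with $\dim X\ge n$, $\kappa_n(X)$ is the norm in $\mathrm M_n(X)$ of the matrix whose first column is $(e_1,\dots,e_n)^T$ and whose other entries are $0$, where $\{e_1,\dots,e_n\}$ is any orthonormal set in $X$ (the value does not depend on the choice). The hypothesis on $\kappa_n(Y)$ for all $n$ includes that $Y$ is infinite-dimensional. A Dvoretzky space for $X$ is an infinite-dimensional homogeneous Hilbertian operator space $Z$ which is completely isometric to a subspace of an ultrapower of $X$ (the ultrapower $X^{\mathcal U}$ carries the operator space structure $\mathrm M_n(X^{\mathcal U})=\mathrm M_n(X)^{\mathcal U}$). A map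 $f\colon B_X\to Y$ is a completely Lipschitz in small scale embedding if there is $L\ge1$ such that $\frac1L\|x-y\|_{\mathrm M_n(X)}\le\|f_n(x)-f_n(y)\|_{\mathrm M_n(Y)}\le L\|x-y\|_{\mathrm M_n(X)}$ for all $n\in\mathbb N$ and all $x,y\in B_{\mathrm M_n(X)}$. For positive sequences, $a_n\gtrsim b_n$ means there is a constant $K>0$ with $a_n\ge Kb_n$ for all $n\in\mathbb N$. *)

(* Defs.v *)
From HB Require Import structures.
From mathcomp Require Import all_boot all_order all_algebra.
From mathcomp Require Import complex sesquilinear.
From mathcomp Require Import all_classical all_reals all_analysis.

Set Implicit Arguments.
Unset Strict Implicit.
Unset Printing Implicit Defensive.

Import Order.TTheory GRing.Theory Num.Theory Num.Def.
Import numFieldNormedType.Exports.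
Import Quotient.

Local Open Scope classical_set_scope.
Local Open Scope ring_scope.
Local Open Scope complex_scope.
Local Open Scope quotient_scope.

(* The inner product is linear in its first argument. *)
HB.mixin Record NormedModule_isHilbert (R : realType) H
    of CompleteNormedModule R[i] H := {
  dot : {dot H for @conjC R[i]} ;
  sqr_norm_dot : forall x : H, `|x| ^+ 2 = dot x x }.
#[short(type="hilbertType")]
HB.structure Definition Hilbert (R : realType) :=
  { H of NormedModule_isHilbert R H & CompleteNormedModule R[i] H }.

(* On a normed module over R[i] the library norm has values in R[i]; hnorm is
   the same norm with values in R. *)
Definition hnorm (R : realType) (H : normedModType R[i]) (x : H) : R :=
  complex.Re `|x|.

Section HnormTheory.
Variables (R : realType) (H : normedModType R[i]).
Implicit Types x y : H.

Lemma hnormE x : `|x| = (hnorm x)%:C.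
Proof.
rewrite /hnorm; have := normr_ge0 x.
by case: `|x| => a b; rewrite lecE /= => /andP[/eqP -> _].
Qed.

Lemma hnorm_ge0 x : 0 <= hnorm x.
Proof. by have := normr_ge0 x; rewrite hnormE lecR. Qed.

Lemma Re_norm_ge0 (a : R[i]) : 0 <= complex.Re `|a|.
Proof. by have := normr_ge0 a; rewrite lecE => /andP[]. Qed.

Lemma hnormD x y : hnorm (x + y) <= hnorm x + hnorm y.
Proof. by have := ler_normD x y; rewrite !hnormE -rmorphD /= lecR. Qed.

Lemma hnormZ (a : R[i]) x : hnorm (a *: x) = complex.Re `|a| * hnorm x.
Proof. by rewrite /hnorm normrZ (hnormE x) normc_def /= mulr0 subr0. Qed.

Lemma hnorm0 : hnorm (0 : H) = 0.
Proof. by rewrite /hnorm normr0. Qed.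

End HnormTheory.

Definition bounded_linear (R : realType) (H : hilbertType R) (T : H -> H) :=
  linear T /\ exists M : R, forall x, hnorm (T x) <= M * hnorm x.

(* bop H is B(H). *)
Section BoundedOperators.
Variables (R : realType) (H : hilbertType R).

Definition bop_pred : {pred H -> H} := [pred T | `[< bounded_linear T >]].

Lemma bop_pred_submod : submod_closed bop_pred.
Proof.
split=> [|a S T].
  apply/asboolP; split=> [b x y|]; first by rewrite /= scaler0 addr0.
  by exists 0 => x; rewrite hnorm0 mul0r.
move=> /asboolP[lS [M1 M1P]] /asboolP[lT [M2 M2P]]; apply/asboolP; split.
  move=> b x y; rewrite !fctE !lS !lT !scalerDr !scalerA [a * b]mulrC.
  by rewrite addrACA.
exists (complex.Re `|a| * M1 + M2) => x.
rewrite (le_trans (hnormD _ _))// mulrDl lerD// hnormZ -mulrA.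
by rewrite ler_wpM2l// Re_norm_ge0.
Qed.

HB.instance Definition _ :=
  GRing.isSubmodClosed.Build R[i] (H -> H) bop_pred bop_pred_submod.

Record bop := Bop { bop_fun :> H -> H; _ : bop_fun \in bop_pred }.

HB.instance Definition _ := [isSub for bop_fun].
HB.instance Definition _ := [Choice of bop by <:].
HB.instance Definition _ := [SubChoice_isSubLmodule of bop by <:].

End BoundedOperators.

(* Only the data of a norm on each M_n(V): the operator space axioms follow from
   the concrete representation in the instances below.  M_0(V) is allowed; its
   norm is 0 in all the instances. *)
HB.mixin Record Lmodule_hasMatrixNorm (R : realType) V of GRing.Lmodule R[i] V
  := { mnorm : forall n, 'M[V]_n -> R }.
#[short(type="matrixNormedType")]
HB.structure Definition MatrixNormed (R : realType) :=
  { V of Lmodule_hasMatrixNorm R V & GRing.Lmodule R[i] V }.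
Arguments mnorm {R s} {n} _ : rename.

(* The norm of V = M_1(V). *)
Definition vnorm (R : realType) (V : matrixNormedType R) (x : V) : R :=
  mnorm (const_mx x : 'M[V]_1).

(* The norm of B(H^n) on M_n(B(H)); vectors of H^n are maps 'I_n -> H. *)
HB.instance Definition _ (R : realType) (H : hilbertType R) :=
  Lmodule_hasMatrixNorm.Build R (bop H) (fun n (T : 'M[bop H]_n) =>
    sup [set Num.sqrt (\sum_i hnorm (\sum_j T i j (xi j)) ^+ 2)
        | xi in [set xi : 'I_n -> H | \sum_j hnorm (xi j) ^+ 2 <= 1]]).

Record opspace (R : realType) := OpSpace {
  op_hilbert : hilbertType R;
  op_pred : {pred bop op_hilbert};
  op_submod : submod_closed op_pred;
  op_closed : forall T : bop op_hilbert,
    (forall e : R, 0 < e -> exists2 S, S \in op_pred & vnorm (T - S) < e) ->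
    T \in op_pred }.

Section OperatorSpaces.
Variables (R : realType) (X : opspace R).

HB.instance Definition _ :=
  GRing.isSubmodClosed.Build R[i] (bop (op_hilbert X)) (@op_pred R X)
    (@op_submod R X).

Record op_sort := OpElt {
  op_val :> bop (op_hilbert X); _ : op_val \in @op_pred R X }.

HB.instance Definition _ := [isSub for op_val].
HB.instance Definition _ := [Choice of op_sort by <:].
HB.instance Definition _ := [SubChoice_isSubLmodule of op_sort by <:].
HB.instance Definition _ := Lmodule_hasMatrixNorm.Build R op_sort
  (fun n (x : 'M[op_sort]_n) => mnorm (map_mx op_val x)).

End OperatorSpaces.

Coercion op_sort : opspace >-> Sortclass.

Section VnormTheory.
Variables (R : realType) (H : hilbertType R).
Implicit Types S T : bop H.

Lemma bop_linear T : linear T.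
Proof. by have /asboolP[] := valP T. Qed.

Lemma vnorm_bopE T : vnorm T = sup [set hnorm (T x) | x in [set x : H | hnorm x <= 1]].
Proof.
rewrite /vnorm /mnorm /=; congr sup; apply/seteqP; split=> r /=.
  move=> [xi]; rewrite !big_ord1 !mxE => h <-; exists (xi ord0).
    by rewrite -(@ler_pXn2r _ 2) ?nnegrE ?hnorm_ge0 // expr1n.
  by rewrite sqrtr_sqr ger0_norm// hnorm_ge0.
move=> [x hx <-]; exists (fun=> x).
  by rewrite /= big_ord1 expr_le1 ?hnorm_ge0.
by rewrite !big_ord1 mxE sqrtr_sqr ger0_norm// hnorm_ge0.
Qed.

Lemma vnorm_bop_has_sup T :
  has_sup [set hnorm (T x) | x in [set x : H | hnorm x <= 1]].
Proof.
split; first by exists (hnorm (T 0)); exists 0 => //=; rewrite hnorm0.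
have /asboolP[_ [M MP]] := valP T; exists `|M| => _ /= [x hx <-].
rewrite (le_trans (MP x))// (le_trans (ler_norm _))// normrM.
by rewrite ler_piMr// ger0_norm// hnorm_ge0.
Qed.

Lemma vnorm_bop_ge0 T : 0 <= vnorm T.
Proof.
rewrite vnorm_bopE; apply: le_trans (hnorm_ge0 (T 0)) _.
apply: ub_le_sup; first exact: (vnorm_bop_has_sup T).2.
by exists 0 => //=; rewrite hnorm0.
Qed.

Lemma vnorm_bop0 : vnorm (0 : bop H) = 0.
Proof.
apply/eqP; rewrite eq_le vnorm_bop_ge0 andbT vnorm_bopE.
apply: ge_sup; first exact: (vnorm_bop_has_sup 0).1.
by move=> _ [x _ <-]; rewrite [X in hnorm X](_ : _ = 0) ?hnorm0.
Qed.

Lemma vnorm_bopDZ (a : R[i]) S T :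
  vnorm (a *: S + T) <= complex.Re `|a| * vnorm S + vnorm T.
Proof.
rewrite [leLHS]vnorm_bopE; apply: ge_sup.
  exact: (vnorm_bop_has_sup _).1.
move=> _ [x hx <-].
rewrite [X in hnorm X](_ : _ = a *: S x + T x) //.
have U (Q : bop H) : hnorm (Q x) <= vnorm Q.
  rewrite vnorm_bopE; apply: ub_le_sup; first exact: (vnorm_bop_has_sup Q).2.
  by exists x.
apply: le_trans (hnormD _ _) _.
by apply: lerD; rewrite ?hnormZ ?ler_wpM2l ?Re_norm_ge0 ?U.
Qed.

End VnormTheory.

Section OpVnormTheory.
Variables (R : realType) (X : opspace R).
Implicit Types x y : X.

Lemma vnorm_opE x : vnorm x = vnorm (val x).
Proof. by rewrite /vnorm {1}/mnorm /=; congr mnorm; apply/matrixP=> i j; rewrite !mxE. Qed.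

Lemma vnorm_ge0 x : 0 <= vnorm x.
Proof. by rewrite vnorm_opE vnorm_bop_ge0. Qed.

Lemma vnorm0 : vnorm (0 : X) = 0.
Proof. by rewrite vnorm_opE raddf0 vnorm_bop0. Qed.

Lemma vnormDZ (a : R[i]) x y :
  vnorm (a *: x + y) <= complex.Re `|a| * vnorm x + vnorm y.
Proof. by rewrite !vnorm_opE linearP vnorm_bopDZ. Qed.

End OpVnormTheory.

(* The ultrapower of X: bounded families modulo the families whose norm tends
   to 0 along the ultrafilter U. *)
Section Ultrapower.
Variables (R : realType) (X : opspace R) (I : Type) (U : set_system I).
Hypothesis FU : UltraFilter U.

Definition bounded_family : {pred I -> X} :=
  [pred x | `[< exists M : R, forall k, vnorm (x k) <= M >]].

Lemma bounded_family_submod : submod_closed bounded_family.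
Proof.
split=> [|a x y].
  by apply/asboolP; exists 0 => k; rewrite vnorm0.
move=> /asboolP[M MP] /asboolP[N NP]; apply/asboolP.
exists (complex.Re `|a| * M + N) => k; apply: le_trans (vnormDZ _ _ _) _.
by apply: lerD; rewrite ?ler_wpM2l ?Re_norm_ge0.
Qed.

HB.instance Definition _ :=
  GRing.isSubmodClosed.Build R[i] (I -> X) bounded_family bounded_family_submod.

Record family := Family { family_fun :> I -> X; _ : family_fun \in bounded_family }.

HB.instance Definition _ := [isSub for family_fun].
HB.instance Definition _ := [Choice of family by <:].
HB.instance Definition _ := [SubChoice_isSubLmodule of family by <:].

Definition null_family : {pred family} :=
  [pred x : family | `[< (fun k => vnorm (x k)) @ U --> (0 : R) >]].

Lemma null_family_submod : submod_closed null_family.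
Proof.
have PU : ProperFilter U := ultra_proper.
split=> [|a x y].
  apply/asboolP; rewrite (_ : (fun _ => _) = cst 0); first exact: cvg_cst.
  by apply/funext => k; rewrite /cst -[RHS](vnorm0 X).
move=> /asboolP x0 /asboolP y0; apply/asboolP.
have h : (fun k => complex.Re `|a| * vnorm (x k) + vnorm (y k)) @ U --> (0 : R).
  rewrite -[X in _ --> X](addr0 (0 : R)) -{1}(mulr0 (complex.Re `|a|)).
  by apply: cvgD => //; apply: cvgM => //; apply: cvg_cst.
apply: squeeze_cvgr (cvg_cst (0 : R)) h; apply: nearW => k.
by rewrite vnorm_ge0 /= vnormDZ.
Qed.

HB.instance Definition _ :=
  GRing.isSubmodClosed.Build R[i] family null_family null_family_submod.

Definition ultrapower := {quot null_family}.

HB.instance Definition _ := GRing.Zmodule.on ultrapower.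

Definition ultra_scale (a : R[i]) : ultrapower -> ultrapower :=
  lift_op1 ultrapower ( *:%R a).

Lemma pi_ultra_scale a : {morph \pi_(ultrapower) : x / a *: x >-> ultra_scale a x}.
Proof.
move=> x; unlock ultra_scale; apply/eqP; rewrite -Quotient.idealrBE -scalerBr.
by rewrite rpredZ// Quotient.idealrBE reprK.
Qed.

Lemma ultra_scaleA a b x : ultra_scale a (ultra_scale b x) = ultra_scale (a * b) x.
Proof. by rewrite -[x]reprK -!pi_ultra_scale scalerA. Qed.

Lemma ultra_scale1 : left_id 1 ultra_scale.
Proof. by move=> x; rewrite -[x]reprK -pi_ultra_scale scale1r. Qed.

Lemma ultra_scaleDr : right_distributive ultra_scale +%R.
Proof.
move=> a x y; rewrite -[x]reprK -[y]reprK -!pi_ultra_scale -!raddfD.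
by rewrite -pi_ultra_scale scalerDr raddfD.
Qed.

Lemma ultra_scaleDl x : {morph ultra_scale^~ x : a b / a + b}.
Proof.
by move=> a b; rewrite -[x]reprK -!pi_ultra_scale scalerDl raddfD.
Qed.

HB.instance Definition _ := GRing.Zmodule_isLmodule.Build R[i] ultrapower
  ultra_scaleA ultra_scale1 ultra_scaleDr ultra_scaleDl.

(* The limit does not depend on the representatives. *)
HB.instance Definition _ := Lmodule_hasMatrixNorm.Build R ultrapower
  (fun n (q : 'M[ultrapower]_n) =>
    lim ((fun k => mnorm (map_mx (fun z => (repr z : family) k) q)) @ U)).

End Ultrapower.

Definition finite_dimensional (R : realType) (V : lmodType R[i]) : Prop :=
  exists (n : nat) (e : 'I_n -> V),
    forall x, exists a : 'I_n -> R[i], x = \sum_i a i *: e i.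

Definition infinite_dimensional (R : realType) (V : lmodType R[i]) : Prop :=
  ~ finite_dimensional V.

Section MatrixNormedSpaces.
Variable R : realType.
Implicit Types V W : matrixNormedType R.

Definition amplification_norm V W (u : V -> W) (n : nat) : \bar R :=
  ereal_sup [set (mnorm (map_mx u x))%:E | x in [set x : 'M[V]_n | mnorm x <= 1]].

Definition operator_norm V W (u : V -> W) : \bar R :=
  ereal_sup [set (vnorm (u x))%:E | x in [set x : V | vnorm x <= 1]].

Definition cb_norm V W (u : V -> W) : \bar R :=
  ereal_sup (range (amplification_norm u)).

Definition homogeneous V : Prop :=
  forall u : {linear V -> V}, (operator_norm u < +oo)%E ->
    cb_norm u = operator_norm u.

Definition hilbert_isometry V (H : hilbertType R) (u : {linear V -> H}) : Prop :=
  bijective u /\ forall x, hnorm (u x) = vnorm x.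

Definition hilbertian V : Prop :=
  exists (H : hilbertType R) (u : {linear V -> H}), hilbert_isometry u.

Definition complete_isometry V W (u : {linear V -> W}) : Prop :=
  forall n (x : 'M[V]_n), mnorm (map_mx u x) = mnorm x.

(* Orthonormality for the Hilbert space structure of a Hilbertian space; by
   polarization it does not depend on the isometry. *)
Definition orthonormal_in V n (e : 'I_n -> V) : Prop :=
  exists (H : hilbertType R) (u : {linear V -> H}), hilbert_isometry u /\
    forall i j, dot (u (e i)) (u (e j)) = (i == j)%:R.

Definition first_column V n (e : 'I_n -> V) : 'M[V]_n :=
  \matrix_(i, j) if j == 0%N :> nat then e i else 0.

(* For V homogeneous Hilbertian of dimension at least n, all orthonormal
   e : 'I_n -> V give the same value, and sup picks this common value.  If
   there is no such e then kappa V n = 0. *)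
Definition kappa V (n : nat) : R :=
  sup [set mnorm (first_column e) | e in [set e : 'I_n -> V | orthonormal_in e]].

Definition unit_ball V := {x : V | vnorm x <= 1}.

(* The entries of a matrix in the unit ball of M_n(V) are in the unit ball of V,
   so the matrices over unit_ball V of norm at most 1 are exactly the elements
   of the unit ball of M_n(V). *)
Definition small_scale_embedding V W (f : unit_ball V -> W) : Prop :=
  exists2 L : R, 1 <= L & forall n (x y : 'M[unit_ball V]_n),
    mnorm (map_mx sval x) <= 1 -> mnorm (map_mx sval y) <= 1 ->
    L^-1 * mnorm (map_mx sval x - map_mx sval y)
      <= mnorm (map_mx f x - map_mx f y)
      <= L * mnorm (map_mx sval x - map_mx sval y).

End MatrixNormedSpaces.

Definition dvoretzky_space (R : realType) (X Z : opspace R) : Prop :=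
  [/\ infinite_dimensional Z, homogeneous Z, hilbertian Z &
    exists (I : Type) (U : set_system I) (FU : UltraFilter U)
      (j : {linear Z -> ultrapower X FU}), complete_isometry j].

(* Sequences are indexed by n >= 1. *)
Definition dominates (R : realType) (a b : nat -> R) : Prop :=
  exists2 K : R, 0 < K & forall n, (0 < n)%N -> K * b n <= a n.

(* Main.v *)
From HB Require Import structures.
From mathcomp Require Import all_boot all_order all_algebra.
From mathcomp Require Import complex sesquilinear.
From mathcomp Require Import all_classical all_reals all_analysis.
From mathcomp Require Import ring lra.
Require Import Defs.

Set Implicit Arguments.
Unset Strict Implicit.
Unset Printing Implicit Defensive.

Import Order.TTheory GRing.Theory Num.Theory Num.Def.
Import numFieldNormedType.Exports.
Import Quotient.

Local Open Scope classical_set_scope.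
Local Open Scope ring_scope.
Local Open Scope complex_scope.
Local Open Scope quotient_scope.

(** The embedding f compares a column of orthonormal vectors of Z with a column of
    almost orthogonal vectors of Y.  Fix n, and let the e_i form an infinite
    orthonormal sequence in Z.  Scaled by t = 1/(2 kappa_n(Z)), a column of n of
    the e_i lies in the unit ball of M_n(Z), so f, transported along the
    ultrapower, is defined on it.  A bounded sequence in a Hilbert space is weakly
    convergent up to a subsequence, so that differences of images of the vectors
    t e_i can be chosen almost orthogonal.  The column of n such differences has norm at most
    a multiple of L, because f is L-Lipschitz on columns.  On the other hand each
    difference has norm at least t/L, because f is L-bounded below on vectors,
    and Y is homogeneous Hilbertian: a column of n almost orthogonal vectors of
    norm at least t/L has norm at least about (t/L) kappa_n(Y).  Hence kappa_n(Z)
    is at least a multiple of kappa_n(Y) / L^2, that is of n^c, and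
    c/(1+2c) <= c because c >= 0.

    Only finitely many vectors are used for each n.  A finite configuration of Z
    is approximated in X itself ([ultrapower_finite_approx]), which avoids
    ultrapowers of Y; and the weak limit is replaced by the pigeonhole principle
    ([almost_orthogonal_pairs]).  The vectors come in n blocks of m, with m large,
    and one difference is taken in each block.  The lower bound for columns in Y
    is [homogeneous_column], where a linear map of norm at most a multiple of
    L/t almost sends the chosen differences to an orthonormal system of Y whose
    column norm is nearly kappa_n(Y).  [kappa_embedding] puts these together. *)

(** * Euclidean norms of finite real families *)

Section EuclideanSums.
Variables (R : realType) (I : finType).
Implicit Types a b : I -> R.

Lemma l2_le_l1 a : (forall i, 0 <= a i) -> Num.sqrt (\sum_i a i ^+ 2) <= \sum_i a i.
Proof.
move=> a0; have s0 : 0 <= \sum_i a i by apply: sumr_ge0.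
rewrite -(ger0_norm s0) -sqrtr_sqr ler_wsqrtr//.
rewrite expr2 big_distrl/=; apply: ler_sum => i _.
rewrite expr2 ler_wpM2l// (bigD1 i)//= lerDl; exact: sumr_ge0.
Qed.

Lemma l2_ge_coord a i : 0 <= a i -> a i <= Num.sqrt (\sum_j a j ^+ 2).
Proof.
move=> a0; rewrite -[leLHS]ger0_norm// -sqrtr_sqr ler_wsqrtr//.
rewrite (bigD1 i)//= lerDl; apply: sumr_ge0 => j _; exact: sqr_ge0.
Qed.

Lemma l2_eq0 a : Num.sqrt (\sum_i a i ^+ 2) = 0 -> forall i, a i = 0.
Proof.
move=> /eqP; rewrite sqrtr_eq0 => s0 i; apply/eqP; rewrite -sqrf_eq0 eq_le sqr_ge0 andbT.
apply: le_trans s0; rewrite (bigD1 i)//= lerDl.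
by apply: sumr_ge0 => j _; exact: sqr_ge0.
Qed.

(** With A and B the two Euclidean norms, the sum of the squares of
    B a_i - A b_i is nonnegative, and equals 2AB (AB - sum a_i b_i). *)
Lemma cauchy_schwarz a b :
  \sum_i a i * b i <= Num.sqrt (\sum_i a i ^+ 2) * Num.sqrt (\sum_i b i ^+ 2).
Proof.
set A := Num.sqrt _; set B := Num.sqrt _.
have sqA : A ^+ 2 = \sum_i a i ^+ 2 by rewrite sqr_sqrtr// sumr_ge0// => i _; exact: sqr_ge0.
have sqB : B ^+ 2 = \sum_i b i ^+ 2 by rewrite sqr_sqrtr// sumr_ge0// => i _; exact: sqr_ge0.
have A0 : 0 <= A := sqrtr_ge0 _; have B0 : 0 <= B := sqrtr_ge0 _.
have [/eqP Aeq|An] := boolP (A == 0).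
  by rewrite Aeq mul0r big1// => i _; rewrite (l2_eq0 Aeq) mul0r.
have [/eqP Beq|Bn] := boolP (B == 0).
  by rewrite Beq mulr0 big1// => i _; rewrite (l2_eq0 Beq) mulr0.
have Ap : 0 < A by rewrite lt_def An.
have Bp : 0 < B by rewrite lt_def Bn.
have P : 0 <= \sum_i (B * a i - A * b i) ^+ 2 by apply: sumr_ge0 => i _; exact: sqr_ge0.
have E : \sum_i (B * a i - A * b i) ^+ 2 = 2 * (A * B) * (A * B - \sum_i a i * b i).
  transitivity (B ^+ 2 * \sum_i a i ^+ 2 + A ^+ 2 * (\sum_i b i ^+ 2)
                - 2 * (A * B) * \sum_i a i * b i).
    rewrite !mulr_sumr -big_split -sumrB/=; apply: eq_bigr => i _; ring.
  rewrite -sqA -sqB; ring.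
by move: P; rewrite E pmulr_rge0 ?subr_ge0// !mulr_gt0.
Qed.

Lemma minkowski a b :
  Num.sqrt (\sum_i (a i + b i) ^+ 2) <=
  Num.sqrt (\sum_i a i ^+ 2) + Num.sqrt (\sum_i b i ^+ 2).
Proof.
have s0 (c : I -> R) : 0 <= \sum_i c i ^+ 2 by apply: sumr_ge0 => i _; exact: sqr_ge0.
rewrite -(@ler_pXn2r _ 2) ?nnegrE ?addr_ge0 ?sqrtr_ge0// sqrrD !sqr_sqrtr//.
have -> : \sum_i (a i + b i) ^+ 2 =
    \sum_i a i ^+ 2 + (\sum_i a i * b i) *+ 2 + \sum_i b i ^+ 2.
  rewrite -sumrMnl -!big_split/=; apply: eq_bigr => i _; exact: sqrrD.
by rewrite lerD2r lerD2l lerMn2r cauchy_schwarz.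
Qed.

Lemma l2Z (c : R) a : 0 <= c ->
  Num.sqrt (\sum_i (c * a i) ^+ 2) = c * Num.sqrt (\sum_i a i ^+ 2).
Proof.
move=> c0; rewrite -{2}(ger0_norm c0) -sqrtr_sqr -sqrtrM ?sqr_ge0//; congr Num.sqrt.
by rewrite mulr_sumr; apply: eq_bigr => i _; rewrite exprMn.
Qed.

End EuclideanSums.

(** * Matrix norms over B(H) and over operator spaces *)

Section MatrixNorms.
Variables (R : realType) (H : hilbertType R).

Lemma hnormZ_real (c : R) (x : H) : 0 <= c -> hnorm (c%:C *: x) = c * hnorm x.
Proof.
by move=> c0; rewrite hnormZ normc_def /= expr0n /= addr0 sqrtr_sqr ger0_norm.
Qed.

Lemma hnorm_unit (x : H) : dot x x = 1 -> hnorm x = 1.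
Proof.
rewrite -sqr_norm_dot => /eqP; rewrite sqrf_eq1 => /orP[]/eqP h; rewrite /hnorm h//.
by have := normr_ge0 x; rewrite h oppr_ge0 ler10.
Qed.

Lemma bop0 (T : bop H) : T 0 = 0.
Proof.
have := bop_linear T 1 0 0; rewrite scaler0 addr0 scale1r => /esym/eqP.
by rewrite -subr_eq0 addrK => /eqP.
Qed.

Lemma hnorm_sum (J : Type) (r : seq J) (P : pred J) (F : J -> H) :
  hnorm (\sum_(i <- r | P i) F i) <= \sum_(i <- r | P i) hnorm (F i).
Proof.
elim/big_ind2 : _ => //; first by rewrite hnorm0.
by move=> x a y b ha hb; apply: le_trans (hnormD _ _) (lerD ha hb).
Qed.

Lemma hnorm_bop_le (T : bop H) x : hnorm (T x) <= vnorm T * hnorm x.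
Proof.
have le1 z : hnorm z <= 1 -> hnorm (T z) <= vnorm T.
  move=> hz; rewrite vnorm_bopE; apply: ub_le_sup; first exact: (vnorm_bop_has_sup T).2.
  by exists z.
have T0 a z : T (a *: z) = a *: T z.
  by have := bop_linear T a z 0; rewrite !addr0 bop0 addr0.
have [x0|xn] := eqVneq (hnorm x) 0.
  have xe : x = 0 by apply: normr0_eq0; rewrite hnormE x0.
  by rewrite x0 mulr0 xe -(scale0r 0) T0 scale0r hnorm0.
have xp : 0 < hnorm x by rewrite lt_def xn hnorm_ge0.
have sZ (z : H) : hnorm (((hnorm x)^-1)%:C *: z) = (hnorm x)^-1 * hnorm z.
  by apply: hnormZ_real; rewrite invr_ge0 ltW.
have := le1 (((hnorm x)^-1)%:C *: x); rewrite T0 !sZ mulVf// lexx => /(_ isT).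
by rewrite mulrC ler_pdivrMr.
Qed.

Section OneMatrix.
Variables (n : nat) (T : 'M[bop H]_n).

Definition image_norm (xi : 'I_n -> H) : R :=
  Num.sqrt (\sum_i hnorm (\sum_j T i j (xi j)) ^+ 2).

Lemma mnorm_bopE : mnorm T = sup [set image_norm xi | xi in
   [set xi : 'I_n -> H | \sum_j hnorm (xi j) ^+ 2 <= 1]].
Proof. by []. Qed.

Lemma image_norm_le_sum xi : \sum_j hnorm (xi j) ^+ 2 <= 1 ->
  image_norm xi <= \sum_i \sum_j vnorm (T i j).
Proof.
move=> hxi; have x1 j : hnorm (xi j) <= 1.
  rewrite -(@ler_pXn2r _ 2) ?nnegrE ?hnorm_ge0// expr1n; apply: le_trans hxi.
  by rewrite (bigD1 j)//= lerDl; apply: sumr_ge0 => k _; exact: sqr_ge0.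
apply: le_trans (l2_le_l1 _) _ => [i|]; first exact: hnorm_ge0.
apply: ler_sum => i _; apply: le_trans (hnorm_sum _ _ _) _.
apply: ler_sum => j _; apply: le_trans (hnorm_bop_le _ _) _.
by rewrite ler_piMr// vnorm_bop_ge0.
Qed.

Lemma image_norm_has_sup : has_sup [set image_norm xi | xi in
   [set xi : 'I_n -> H | \sum_j hnorm (xi j) ^+ 2 <= 1]].
Proof.
split; last by exists (\sum_i \sum_j vnorm (T i j)) => _ [xi hx <-]; exact: image_norm_le_sum.
exists (image_norm (fun=> 0)); exists (fun=> 0) => //=.
by rewrite big1// => j _; rewrite hnorm0 expr0n.
Qed.

Lemma image_norm_le_mnorm xi : \sum_j hnorm (xi j) ^+ 2 <= 1 -> image_norm xi <= mnorm T.
Proof.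
move=> h; rewrite mnorm_bopE; apply: ub_le_sup; last by exists xi.
exact: image_norm_has_sup.2.
Qed.

Lemma mnorm_le_image_norm M :
  (forall xi, \sum_j hnorm (xi j) ^+ 2 <= 1 -> image_norm xi <= M) -> mnorm T <= M.
Proof.
move=> h; rewrite mnorm_bopE; apply: ge_sup; first exact: image_norm_has_sup.1.
by move=> _ [xi hx <-]; exact: h.
Qed.

Lemma mnorm_bop_le_sum : mnorm T <= \sum_i \sum_j vnorm (T i j).
Proof. by apply: mnorm_le_image_norm => xi; exact: image_norm_le_sum. Qed.

(** Test the matrix on vectors of H^n supported on the j-th coordinate. *)
Lemma mnorm_bop_ge_entry i j : vnorm (T i j) <= mnorm T.
Proof.
rewrite vnorm_bopE; apply: ge_sup; first exact: (vnorm_bop_has_sup _).1.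
move=> _ [x hx <-]; pose xi k := if k == j then x else 0.
have -> : T i j x = \sum_k T i k (xi k).
  rewrite (bigD1 j)//= /xi eqxx big1 ?addr0// => k /negPf ->; exact: bop0.
apply: le_trans (image_norm_le_mnorm (xi := xi) _).
  apply: (@l2_ge_coord _ _ (fun i0 => hnorm (\sum_j T i0 j (xi j))) i); exact: hnorm_ge0.
rewrite (bigD1 j)//= /xi eqxx big1 ?addr0 ?expr_le1 ?hnorm_ge0// => k /negPf ->.
by rewrite hnorm0 expr0n.
Qed.

Lemma mnorm_bop_ge0 : 0 <= mnorm T.
Proof.
apply: le_trans (image_norm_le_mnorm (xi := fun=> 0) _); first exact: sqrtr_ge0.
by rewrite big1// => j _; rewrite hnorm0 expr0n.
Qed.

End OneMatrix.

Lemma mnorm_bopD n (S T : 'M[bop H]_n) : mnorm (S + T) <= mnorm S + mnorm T.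
Proof.
apply: mnorm_le_image_norm => xi hx.
apply: le_trans (lerD (image_norm_le_mnorm S hx) (image_norm_le_mnorm T hx)).
apply: le_trans (minkowski _ _); rewrite ler_wsqrtr//; apply: ler_sum => i _.
rewrite lerXn2r ?nnegrE ?addr_ge0 ?hnorm_ge0//; apply: le_trans (hnormD _ _).
by rewrite -big_split/=; under eq_bigr do rewrite mxE.
Qed.

Lemma mnorm_bopZ n (c : R) (T : 'M[bop H]_n) : 0 <= c ->
  mnorm (map_mx ( *:%R c%:C) T) <= c * mnorm T.
Proof.
move=> c0; apply: mnorm_le_image_norm => xi hx.
apply: le_trans (ler_wpM2l c0 (image_norm_le_mnorm T hx)).
rewrite -l2Z// ler_wsqrtr//; apply: ler_sum => i _.
rewrite (_ : \sum_j _ = c%:C *: \sum_j T i j (xi j)).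
  by rewrite hnormZ_real.
by rewrite scaler_sumr; apply: eq_bigr => j _; rewrite mxE.
Qed.

End MatrixNorms.

Section OpspaceNorms.
Variables (R : realType) (X : opspace R) (n : nat).
Implicit Types S T : 'M[X]_n.

Lemma mnorm_ge0 T : 0 <= mnorm T.
Proof. exact: mnorm_bop_ge0. Qed.

Lemma mnormD S T : mnorm (S + T) <= mnorm S + mnorm T.
Proof.
apply: le_trans (mnorm_bopD _ _); rewrite {1}/mnorm /=.
rewrite (_ : map_mx _ _ = map_mx (@op_val R X) S + map_mx (@op_val R X) T)//.
by apply/matrixP => i j; rewrite !mxE.
Qed.

Lemma mnormZ (c : R) T : 0 <= c -> mnorm (map_mx ( *:%R c%:C) T) <= c * mnorm T.
Proof.
move=> c0; apply: le_trans (mnorm_bopZ _ c0); rewrite {1}/mnorm /=.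
rewrite (_ : map_mx _ _ = map_mx ( *:%R c%:C) (map_mx (@op_val R X) T))//.
by apply/matrixP => i j; rewrite !mxE.
Qed.

Lemma mnorm_le_sum T : mnorm T <= \sum_i \sum_j vnorm (T i j).
Proof.
apply: le_trans (mnorm_bop_le_sum _) _.
by apply: ler_sum => i _; apply: ler_sum => j _; rewrite mxE vnorm_opE.
Qed.

Lemma vnorm_le_mnorm T i j : vnorm (T i j) <= mnorm T.
Proof.
rewrite vnorm_opE.
by have := mnorm_bop_ge_entry (map_mx (@op_val R X) T) i j; rewrite mxE.
Qed.

Lemma mnormN T : mnorm (- T) = mnorm T.
Proof.
suff h S : mnorm (- S) <= mnorm S by apply: le_anti; rewrite h -{1}[T]opprK h.
apply: mnorm_le_image_norm => xi hx.
apply: le_trans (image_norm_le_mnorm (map_mx (@op_val R X) S) hx).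
rewrite ler_wsqrtr//; apply: ler_sum => i _.
rewrite lerXn2r ?nnegrE ?hnorm_ge0//.
rewrite (_ : \sum_j _ = - \sum_j map_mx (@op_val R X) S i j (xi j)).
  by rewrite /hnorm normrN.
by rewrite -sumrN; apply: eq_bigr => j _; rewrite !mxE.
Qed.

Lemma mnormB S T : mnorm (S - T) <= mnorm S + mnorm T.
Proof. by rewrite -(mnormN T) mnormD. Qed.

End OpspaceNorms.

(** * Norms in an ultrapower as limits *)

Section UltraLimits.
Variables (R : realType) (I : Type) (U : set_system I).
Hypothesis FU : UltraFilter U.

Lemma ultra_fmap (T : Type) (f : I -> T) : UltraFilter (f @ U).
Proof.
have PU : ProperFilter U := @ultra_proper _ _ FU.
split; first exact: fmap_proper_filter.
move=> G PG sG; apply/seteqP; split=> // A GA.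
have [//|UA] := in_ultra_setVsetC (f @^-1` A) FU.
have GcA : G (~` A) by exact: sG.
by have /filter_ex [? []] : G (A `&` ~` A) by exact: filterI.
Qed.

Lemma bounded_ultra_cvg (f : I -> R) (a b : R) :
  (forall k, a <= f k <= b) -> exists l : R, f @ U --> l.
Proof.
move=> fab; have PU : ProperFilter U := @ultra_proper _ _ FU.
have := @segment_compact R a b; rewrite compact_ultra => /(_ _ (ultra_fmap f)).
case=> [|l [_ fl]]; last by exists l.
by apply: (filterE (F := U)) => k; rewrite /preimage /= in_itv; exact: fab.
Qed.

Variable X : opspace R.
Let PU : ProperFilter U := @ultra_proper _ _ FU.

Let at_ n k : 'M[family X I]_n -> 'M[X]_n := map_mx (fun z : family X I => z k).

Lemma family_bounded (z : family X I) : exists M : R, forall k, vnorm (z k) <= M.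
Proof. by have /asboolP := valP z. Qed.

(** The norm in the ultrapower is defined as the limit for chosen representatives;
    arbitrary ones are needed because the representative chosen for 0 need not be
    the zero family.  The limit exists because the norms are
    bounded.  Two representatives of the same entry differ by a null family, and the norm
    of a matrix is at most the sum of the norms of its entries, so the norms of
    the two matrices of representatives differ by a quantity tending to 0. *)
Lemma ultrapower_mnorm_cvg n (q : 'M[ultrapower X FU]_n) (F : 'M[family X I]_n) :
  (forall i j, \pi_(ultrapower X FU) (F i j) = q i j) ->
  (fun k => mnorm (map_mx (fun z : family X I => z k) F)) @ U --> mnorm q.
Proof.
move=> Fq; pose G : 'M[family X I]_n := map_mx (fun z => repr z) q.
have GE k : map_mx (fun z : ultrapower X FU => (repr z : family X I) k) q = at_ k G.
  by apply/matrixP => i j; rewrite !mxE.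
pose N k := mnorm (at_ k G).
have cG : N @ U --> mnorm q.
  have [l Nl] : exists l : R, N @ U --> l.
    have [M MP] : exists M : R, forall k, N k <= M.
      pose B i j := xget 0 [set M : R | forall k, vnorm (G i j k) <= M].
      have BP i j k : vnorm (G i j k) <= B i j.
        have [M MP] := family_bounded (G i j).
        by have := xgetI 0 (MP : [set M : R | forall k, vnorm (G i j k) <= M] M); apply.
      exists (\sum_i \sum_j B i j) => k; apply: le_trans (mnorm_le_sum _) _.
      by apply: ler_sum => i _; apply: ler_sum => j _; rewrite mxE.
    by apply: (@bounded_ultra_cvg _ 0 M) => k; rewrite mnorm_ge0 MP.
  have -> : mnorm q = lim (N @ U).
    by rewrite {1}/mnorm /=; congr (lim (_ @ U)); apply/funext => k; rewrite GE.
  by rewrite (cvg_lim _ Nl).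
pose D k := \sum_i \sum_j vnorm ((F i j - G i j) k).
have D0 : D @ U --> (0 : R).
  have -> : (0 : R) = \sum_(i < n) \sum_(j < n) 0 by rewrite big1// => i _; rewrite big1.
  apply: cvg_big => [|i _]; first exact: add_continuous.
  apply: cvg_big => [|j _]; first exact: add_continuous.
  have : F i j - G i j \in @null_family R X I U.
    by rewrite (@Quotient.idealrBE _ (@null_family R X I U)); apply/eqP; rewrite Fq mxE reprK.
  by move=> /asboolP.
have FGE k : at_ k F = at_ k G + \matrix_(i, j) ((F i j - G i j) k).
  apply/matrixP => i j; rewrite !mxE.
  have -> : (F i j - repr (q i j)) k = F i j k - repr (q i j) k by [].
  by rewrite addrC subrK.
have up k : mnorm (at_ k F) <= N k + D k.
  rewrite FGE; apply: le_trans (mnormD _ _) _; rewrite lerD2l.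
  apply: le_trans (mnorm_le_sum _) _.
  by apply: ler_sum => i _; apply: ler_sum => j _; rewrite mxE.
have lo k : N k - D k <= mnorm (at_ k F).
  rewrite lerBlDr.
  have -> : N k = mnorm (at_ k F - \matrix_(i, j) ((F i j - G i j) k)) by rewrite FGE addrK.
  apply: le_trans (mnormB _ _) _; rewrite lerD2l.
  apply: le_trans (mnorm_le_sum _) _.
  by apply: ler_sum => i _; apply: ler_sum => j _; rewrite mxE.
apply: (squeeze_cvgr (f := fun k => N k - D k) (h := fun k => N k + D k)).
- by apply: nearW => k; rewrite lo up.
- by rewrite -[X in _ --> X]subr0; apply: cvgB.
- by rewrite -[X in _ --> X]addr0; apply: cvgD.
Qed.

End UltraLimits.

(** * Orthonormal systems in a Hilbert space *)

Section HilbertGeometry.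
Variables (R : realType) (H : hilbertType R).
Implicit Types x y : H.

Definition orthonormal_family (I : eqType) (g : I -> H) :=
  forall i j, dot (g i) (g j) = (i == j)%:R.

Lemma dotC x y : dot x y = conjC (dot y x).
Proof. by rewrite (hermC dot) expr0 mul1r. Qed.

Lemma dot_suml (I : finType) (F : I -> H) y :
  dot (\sum_i F i) y = \sum_i dot (F i) y.
Proof.
elim/big_rec2 : _ => [|i a b _ <-]; first by rewrite linear0l.
by rewrite linearDl.
Qed.

Lemma dotDl x y z : dot (x + y) z = dot x z + dot y z.
Proof. exact: linearDl. Qed.

Lemma dotDr x y z : dot x (y + z) = dot x y + dot x z.
Proof. exact: linearDr. Qed.

Lemma dotZl (a : R[i]) x y : dot (a *: x) y = a * dot x y.
Proof. by rewrite linearZl. Qed.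

Lemma dotZr (a : R[i]) x y : dot x (a *: y) = conjC a * dot x y.
Proof. by rewrite dotC dotZl rmorphM (dotC x y). Qed.

Section Orthonormal.
Variables (I : finType) (g : I -> H).
Hypothesis og : orthonormal_family g.

Lemma dot_comb (a : I -> R[i]) j : dot (\sum_i a i *: g i) (g j) = a j.
Proof.
rewrite dot_suml (bigD1 j)//= dotZl og eqxx mulr1 big1 ?addr0// => i /negPf ij.
by rewrite dotZl og ij mulr0.
Qed.

Lemma norm_comb (a : I -> R[i]) : `|\sum_i a i *: g i| ^+ 2 = \sum_i `|a i| ^+ 2.
Proof.
rewrite sqr_norm_dot {1}dot_suml; apply: eq_bigr => i _.
by rewrite dotZl dotC dot_comb normCK.
Qed.

Definition residual x := x - \sum_i dot x (g i) *: g i.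

Lemma dot_residual x j : dot (residual x) (g j) = 0.
Proof. by rewrite linearBl/= dot_comb subrr. Qed.

Lemma bessel x : \sum_i `|dot x (g i)| ^+ 2 <= `|x| ^+ 2.
Proof.
set p := \sum_i dot x (g i) *: g i.
have rp : dot (residual x) p = 0.
  rewrite dotC dot_suml big1 ?rmorph0// => i _.
  by rewrite dotZl (dotC (g i)) dot_residual rmorph0 mulr0.
have xE : x = residual x + p by rewrite subrK.
move: (residual x) rp xE => r rp xE.
rewrite -norm_comb -/p {1}xE !sqr_norm_dot dotDl !dotDr rp (dotC p r) rp rmorph0.
rewrite addr0 add0r lerDr -sqr_norm_dot; exact: exprn_ge0.
Qed.

Lemma dot_le_norm x i : complex.Re `|dot x (g i)| <= hnorm x.
Proof.
have : `|dot x (g i)| <= `|x|.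
  rewrite -(@ler_pXn2r _ 2)// ?nnegrE//; apply: le_trans (bessel x).
  by rewrite (bigD1 i)//= lerDl sumr_ge0// => j _; exact: exprn_ge0.
by rewrite lecE => /andP[].
Qed.

Lemma hnorm_residual x :
  hnorm x <= hnorm (residual x) + \sum_i complex.Re `|dot x (g i)|.
Proof.
rewrite -[x in leLHS](subrK (\sum_i dot x (g i) *: g i)).
apply: le_trans (hnormD _ _) _; rewrite lerD2l.
apply: le_trans (hnorm_sum _ _ _) _; apply: ler_sum => i _.
by rewrite hnormZ (hnorm_unit (x := g i)) ?mulr1// og eqxx.
Qed.

(** One Gram-Schmidt step: the normalized residual h of x extends the system,
    and the coefficient of x along h is exactly the norm of the residual. *)
Lemma unit_residual x : residual x != 0 -> exists h : H,
  [/\ dot h h = 1, forall i, dot h (g i) = 0, dot x h = `|residual x| &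
      x = `|residual x| *: h + \sum_i dot x (g i) *: g i].
Proof.
set r := residual x => rn; have nr : `|r| != 0 by rewrite normr_eq0.
have cn : conjC (`|r|^-1) = `|r|^-1 by rewrite conj_Creal// realV normr_real.
have xE : x = r + \sum_i dot x (g i) *: g i by rewrite subrK.
exists (`|r|^-1 *: r); split.
- by rewrite dotZl dotZr cn -sqr_norm_dot expr2 mulKf ?mulVf.
- by move=> i; rewrite dotZl dot_residual mulr0.
- rewrite {1}xE dotDl dot_suml [X in _ + X]big1 ?addr0 => [|i _].
    by rewrite dotZr cn -sqr_norm_dot expr2 mulKf.
  by rewrite dotZl dotZr (dotC (g i)) dot_residual rmorph0 !mulr0.
- by rewrite scalerA divff// scale1r.
Qed.

End Orthonormal.

Lemma orthonormal_extend n (g : 'I_n -> H) h : orthonormal_family g ->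
  dot h h = 1 -> (forall i, dot h (g i) = 0) ->
  orthonormal_family (fun i : 'I_n.+1 => oapp g h (unlift ord_max i)).
Proof.
move=> og h1 hg i j; case: unliftP => [i'|] ->; case: unliftP => [j'|] -> /=.
- by rewrite og (inj_eq (@lift_inj _ _)).
- by rewrite dotC hg rmorph0 eq_sym (negPf (neq_lift _ _)).
- by rewrite hg (negPf (neq_lift _ _)).
- by rewrite h1 eqxx.
Qed.

Lemma infinite_orthonormal (V : lmodType R[i]) (u : {linear V -> H}) n :
  bijective u -> infinite_dimensional V ->
  exists e : 'I_n -> V, orthonormal_family (u \o e).
Proof.
move=> [v uK vK] infV; elim: n => [|n [e oe]]; first by exists (fun=> 0) => -[].
have [x xe] : exists x : V, residual (u \o e) (u x) != 0.
  apply: contrapT => ne; apply: infV; exists n, e => x.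
  exists (fun i => dot (u x) (u (e i))); apply: (can_inj uK).
  have : residual (u \o e) (u x) = 0.
    by apply/eqP; apply: contrapT => /negP nz; apply: ne; exists x.
  move=> /eqP; rewrite subr_eq0 => /eqP E; rewrite {1}E linear_sum/=.
  by apply: eq_bigr => i _; rewrite linearZ.
have [h [h1 hg _ _]] := unit_residual oe xe.
exists (fun i => oapp e (v h) (unlift ord_max i)).
have := orthonormal_extend oe h1 hg; congr (orthonormal_family _).
by apply/funext => i /=; case: unlift => //=; rewrite vK.
Qed.

Lemma infinite_orthonormal_fin (I : finType) (V : lmodType R[i]) (u : {linear V -> H}) :
  bijective u -> infinite_dimensional V ->
  exists e : I -> V, orthonormal_family (u \o e).
Proof.
move=> bu /(infinite_orthonormal #|I| bu)[e oe].
by exists (e \o enum_rank) => i j /=; rewrite [LHS]oe (inj_eq enum_rank_inj).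
Qed.

End HilbertGeometry.

(** * Almost orthogonal differences in a bounded separated set *)

Section AlmostOrthogonal.
Variable R : realType.

Lemma Re_norm_le (z : R[i]) :
  complex.Re `|z| <= `|complex.Re z| + `|complex.Im z|.
Proof.
case: z => a b; rewrite normc_def /= -(ler_pXn2r (n := 2)) ?nnegrE ?sqrtr_ge0 ?addr_ge0//.
rewrite sqr_sqrtr ?addr_ge0 ?sqr_ge0// sqrrD !real_normK ?num_real// addrAC lerDl.
by rewrite mulrn_wge0// mulr_ge0.
Qed.

Lemma normRe_le (z : R[i]) : `|complex.Re z| <= complex.Re `|z|.
Proof. by case: z => a b; rewrite normc_def /= -sqrtr_sqr ler_wsqrtr// lerDl sqr_ge0. Qed.

Lemma normIm_le (z : R[i]) : `|complex.Im z| <= complex.Re `|z|.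
Proof. by case: z => a b; rewrite normc_def /= -sqrtr_sqr ler_wsqrtr// lerDr sqr_ge0. Qed.

(** Pigeonhole: cut [-B, B] into intervals of length eps; there are only finitely
    many ways to assign one interval to each coordinate. *)
Lemma close_pair (J : finType) (B eps : R) : 0 < eps ->
  exists m0, forall m, (m0 < m)%N -> forall phi : 'I_m -> J -> R,
    (forall a j, `|phi a j| <= B) ->
    exists a b, a != b /\ forall j, `|phi a j - phi b j| <= eps.
Proof.
move=> eps0; pose K := Num.truncn (2 * B / eps).
exists #|{ffun J -> 'I_K.+1}| => m ltm phi phiB.
pose t a j : R := (phi a j + B) / eps.
have t0 a j : 0 <= t a j.
  by rewrite divr_ge0 ?(ltW eps0)// -lerBlDr sub0r; have := phiB a j; rewrite ler_norml => /andP[].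
have tK a j : (Num.truncn (t a j) < K.+1)%N.
  rewrite ltnS; apply: le_truncn; rewrite ler_wpM2r ?invr_ge0 ?(ltW eps0)//.
  by have := phiB a j; rewrite ler_norml => /andP[_]; lra.
pose cell a : {ffun J -> 'I_K.+1} := [ffun j => inord (Num.truncn (t a j))].
have : ~~ injectiveb cell.
  by apply: contraL ltm => /injectiveP/leq_card; rewrite card_ord leqNgt.
move=> /injectivePn[a [b ab cab]]; exists a, b; split=> // j.
have := congr1 (fun f : {ffun J -> 'I_K.+1} => val (f j)) cab; rewrite /= !ffunE !inordK// => tab.
have /andP[a1 a2] := truncn_itv (t0 a j); have /andP[b1 b2] := truncn_itv (t0 b j).
have : `|t a j - t b j| <= 1.
  rewrite -natr1 in a2; rewrite -natr1 in b2; rewrite tab in a1 a2.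
  rewrite ler_norml; lra.
rewrite /t -mulrBl opprD addrACA subrr addr0 normrM normfV (gtr0_norm eps0).
by rewrite ler_pdivrMr// mul1r.
Qed.

Variable H : hilbertType R.

(** A finite substitute for passing to a weakly convergent subsequence.  Pairs
    are chosen one block after the other.  When the first n differences are
    chosen, with g their Gram-Schmidt system, the coordinates of the points of
    the next block along g are bounded, so two points of that block have nearly
    the same coordinates: their difference w is almost orthogonal to g but has
    norm at least d.  The normalized residual of w is the next vector of g. *)
Lemma almost_orthogonal_pairs n (B d eps : R) :
  0 < d -> 0 < eps -> n%:R * (2 * eps) <= d / 2 ->
  exists m0, forall m, (m0 < m)%N -> forall z : 'I_n -> 'I_m -> H,
    (forall k a, hnorm (z k a) <= B) ->
    (forall k a b, a != b -> d <= hnorm (z k a - z k b)) ->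
    exists (s s' : 'I_n -> 'I_m) (g : 'I_n -> H),
      [/\ orthonormal_family g,
        forall k, d / 2 <= complex.Re `|dot (z k (s k) - z k (s' k)) (g k)| &
        forall k l, k != l -> complex.Re `|dot (z k (s k) - z k (s' k)) (g l)| <= 2 * eps].
Proof.
move=> d0 eps0 nd.
(* The induction also carries that each difference lies in the span of g (in
   the form: it is orthogonal to whatever is orthogonal to g), so that it has no
   component along the vectors of g that come later. *)
suff [m0 hm0] : exists m0, forall m, (m0 < m)%N -> forall z : 'I_n -> 'I_m -> H,
    (forall k a, hnorm (z k a) <= B) ->
    (forall k a b, a != b -> d <= hnorm (z k a - z k b)) ->
    exists (s s' : 'I_n -> 'I_m) (g : 'I_n -> H),
      [/\ orthonormal_family g,
        forall k, d / 2 <= complex.Re `|dot (z k (s k) - z k (s' k)) (g k)|,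
        forall k l, k != l -> complex.Re `|dot (z k (s k) - z k (s' k)) (g l)| <= 2 * eps &
        forall k v, (forall l, dot (g l) v = 0) -> dot (z k (s k) - z k (s' k)) v = 0].
  exists m0 => m ltm z zB zd; have [s [s' [g [og h1 h2 _]]]] := hm0 m ltm z zB zd.
  by exists s, s', g.
elim: n nd => [|n IH] nd.
  by exists 0%N => m m_gt0 z _ _; exists (fun=> Ordinal m_gt0), (fun=> Ordinal m_gt0), (fun=> 0);
    split; case.
have [|m0 hm0] := IH.
  by apply: le_trans nd; rewrite ler_wpM2r ?ler_nat// mulr_ge0// ltW.
have [m1 hm1] := @close_pair ('I_n * bool)%type B eps eps0.
exists (maxn m0 m1) => m; rewrite gtn_max => /andP[ltm0 ltm1] z zB zd.
pose z0 k := z (lift ord_max k).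
have [s [s' [g [og hd he hv]]]] := hm0 m ltm0 z0 (fun k => zB _) (fun k => zd _).
pose y := z ord_max.
pose phi a (j : 'I_n * bool) :=
  if j.2 then complex.Re (dot (y a) (g j.1)) else complex.Im (dot (y a) (g j.1)).
have [|a [b [ab phiab]]] := hm1 m ltm1 phi.
  move=> a [j []]; rewrite /phi /=; apply: le_trans (le_trans _ (dot_le_norm og (y a) j)) (zB _ _).
  - exact: normRe_le.
  - exact: normIm_le.
pose w := y a - y b.
have wg l : complex.Re `|dot w (g l)| <= 2 * eps.
  have dE : dot w (g l) = dot (y a) (g l) - dot (y b) (g l) by exact: linearBl.
  apply: le_trans (Re_norm_le _) _; rewrite mulrDl mul1r dE !raddfB.
  by apply: lerD; [exact: (phiab (l, true))|exact: (phiab (l, false))].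
have rd : d / 2 <= hnorm (residual g w).
  have := hnorm_residual og w; have := zd ord_max _ _ ab; rewrite -/y -/w.
  have : \sum_i complex.Re `|dot w (g i)| <= d / 2.
    apply: le_trans nd; apply: le_trans (ler_sum _ (fun i _ => wg i)) _.
    by rewrite sumr_const card_ord -[leLHS]mulr_natl ler_wpM2r ?ler_nat// mulr_ge0// ltW.
  lra.
have r0 : residual g w != 0.
  by apply: contraTneq rd => ->; rewrite hnorm0 -ltNge divr_gt0.
have [h [h1 hg wh wE]] := unit_residual og r0.
exists (fun i => oapp s a (unlift ord_max i)), (fun i => oapp s' b (unlift ord_max i)),
  (fun i => oapp g h (unlift ord_max i)).
have gl i : dot (g i) h = 0 by rewrite dotC hg rmorph0.
have og' := orthonormal_extend og h1 hg.
have lnone : unlift (@ord_max n) ord_max = None by exact: unlift_none.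
split=> //.
- move=> k; case: (unliftP ord_max k) => [k'|] -> /=; rewrite ?liftK ?lnone /=; first exact: hd.
  apply: le_trans rd _; rewrite -/y -/w wh hnormE /= expr0n /= addr0 sqrtr_sqr.
  exact: ler_norm.
- move=> k l; case: (unliftP ord_max k) => [k'|] ->; case: (unliftP ord_max l) => [l'|] -> /=;
    rewrite ?liftK ?lnone /= => kl; first by apply: he; apply: contra kl => /eqP ->.
  + by rewrite hv//= expr0n /= addr0 sqrtr0 mulr_ge0// ltW.
  + exact: wg.
  + by rewrite eqxx in kl.
- move=> k v vg; have vl l : dot (g l) v = 0 by have := vg (lift ord_max l); rewrite liftK.
  have vh : dot h v = 0 by have := vg ord_max; rewrite lnone.
  case: (unliftP ord_max k) => [k'|] ->; rewrite ?liftK ?lnone /=; first exact: hv.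
  rewrite -/y -/w wE dotDl dotZl vh mulr0 add0r dot_suml big1// => i _.
  by rewrite dotZl vl mulr0.
Qed.

End AlmostOrthogonal.

(** * Columns in a homogeneous Hilbertian space *)

Section Homogeneous.
Variable R : realType.

Lemma normcE (z : R[i]) : `|z| = (complex.Re `|z|)%:C.
Proof. by rewrite normc_def. Qed.

Lemma homogeneous_mnorm (Y : opspace R) (T : {linear Y -> Y}) (C : R) n (x : 'M[Y]_n) :
  homogeneous Y -> 0 < C -> (forall y, vnorm (T y) <= C * vnorm y) ->
  mnorm (map_mx T x) <= C * mnorm x.
Proof.
move=> hom C0 TC.
have opC : (operator_norm T <= C%:E)%E.
  apply: ge_ereal_sup => _ [y /= y1 <-]; rewrite lee_fin; apply: le_trans (TC y) _.
  by rewrite ler_piMr// ltW.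
have cbC : (cb_norm T <= C%:E)%E by rewrite hom//; apply: le_lt_trans opC _; rewrite ltry.
have ball (y : 'M[Y]_n) : mnorm y <= 1 -> mnorm (map_mx T y) <= C.
  move=> y1; rewrite -lee_fin; apply: le_trans cbC.
  apply: (@le_trans _ _ (amplification_norm T n)); last by apply: ereal_sup_ubound; exists n.
  by apply: ereal_sup_ubound; exists y.
(* Dividing by mnorm x itself fails when it is 0. *)
apply/ler_addgt0Pr => e e0.
pose s := mnorm x + e / C.
have s0 : 0 < s by rewrite ltr_wpDl ?mnorm_ge0// divr_gt0.
have sx : mnorm (map_mx ( *:%R (s^-1)%:C) x) <= 1.
  apply: le_trans (mnormZ _ _) _; first by rewrite invr_ge0 ltW.
  by rewrite ler_pdivrMl// mulr1 lerDl ltW// divr_gt0.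
have -> : map_mx T x = map_mx ( *:%R s%:C) (map_mx T (map_mx ( *:%R (s^-1)%:C) x)).
  apply/matrixP => i j; rewrite !mxE linearZ scalerA -rmorphM/= divff ?gt_eqF//.
  by rewrite scale1r.
apply: le_trans (mnormZ _ (ltW s0)) _.
apply: le_trans (ler_wpM2l (ltW s0) (ball _ sx)) _.
by rewrite /s mulrDl mulfVK ?gt_eqF// mulrC.
Qed.

(** The map T sending y to the sum of the <y, g_l> / <w_l, g_l> e_l has norm at
    most 1/d by Bessel, hence completely bounded norm at most 1/d by homogeneity.
    It sends w_k to e_k up to an error of size n h / d, so the column of the e_k
    is the image of the column of the w_k up to a small column. *)
Lemma homogeneous_column (Y : opspace R) (H : hilbertType R) (u : {linear Y -> H})
    n (e w : 'I_n -> Y) (g : 'I_n -> H) (d h : R) :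
  homogeneous Y -> hilbert_isometry u ->
  orthonormal_family (u \o e) -> orthonormal_family g -> 0 < d -> 0 <= h ->
  (forall k, d <= complex.Re `|dot (u (w k)) (g k)|) ->
  (forall k l, k != l -> complex.Re `|dot (u (w k)) (g l)| <= h) ->
  mnorm (first_column e) <= d^-1 * mnorm (first_column w) + n%:R * (n%:R * (n%:R * (d^-1 * h))).
Proof.
move=> hom [_ iso] oe og d0 h0 wd wh.
have dV0 : 0 <= d^-1 by rewrite invr_ge0 ltW.
pose c l (x : H) : R[i] := dot x (g l) / dot (u (w l)) (g l).
have cle l x : `|c l x| <= (d^-1)%:C * `|dot x (g l)|.
  rewrite /c normrM normfV mulrC ler_wpM2r// rmorphV ?unitfE ?gt_eqF//=.
  have dd : d%:C <= `|dot (u (w l)) (g l)| by rewrite normcE lecR.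
  have d0' : 0 < d%:C by rewrite ltcR.
  by rewrite lef_pV2// posrE// (lt_le_trans d0').
pose T (y : Y) : Y := \sum_l c l (u y) *: e l.
have lT : linear T.
  move=> a x y; rewrite /T scaler_sumr -big_split/=; apply: eq_bigr => l _.
  by rewrite scalerA -scalerDl /c linearP dotDl dotZl mulrDl mulrA.
pose TL : {linear Y -> Y} := HB.pack T (GRing.isLinear.Build R[i] Y Y *:%R T lT).
have uT y : u (T y) = \sum_l c l (u y) *: (u \o e) l.
  by rewrite /T linear_sum; apply: eq_bigr => l _; rewrite linearZ.
have TLE y : vnorm (TL y) <= d^-1 * vnorm y.
  rewrite -!iso; suff : `|u (T y)| <= (d^-1)%:C * `|u y|.
    by rewrite !hnormE -rmorphM lecR.
  rewrite -(@ler_pXn2r _ 2)// ?nnegrE ?mulr_ge0// ?lecR// uT norm_comb//.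
  rewrite exprMn; apply: le_trans (ler_wpM2l _ (bessel og (u y))); last first.
    by apply: exprn_ge0; rewrite lecR.
  rewrite mulr_sumr; apply: ler_sum => l _; rewrite -exprMn.
  by rewrite lerXn2r ?nnegrE ?mulr_ge0// lecR.
have cb := homogeneous_mnorm (first_column w) hom (_ : 0 < d^-1) TLE.
apply: le_trans (lerD (cb _) (lexx _)); last by rewrite invr_gt0.
pose r k := e k - TL (w k).
have -> : first_column e = map_mx TL (first_column w) + first_column r.
  apply/matrixP => i j; rewrite !mxE; case: ifP => _; first by rewrite addrC subrK.
  by rewrite linear0 addr0.
apply: le_trans (mnormD _ _) _; rewrite lerD2l.
have c1 k : c k (u (w k)) = 1.
  rewrite /c divff// -normr_gt0 (lt_le_trans _ (_ : d%:C <= _)) ?ltcR//.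
  by rewrite normcE lecR.
have rk k : vnorm (r k) <= n%:R * (d^-1 * h).
  rewrite -iso.
  have -> : u (r k) = - \sum_(l | l != k) c l (u (w k)) *: u (e l).
    by rewrite /r linearB /= uT (bigD1 k)//= c1 scale1r opprD addrA subrr add0r.
  have hN (v : H) : hnorm (- v) = hnorm v by rewrite /hnorm normrN.
  rewrite hN; apply: le_trans (hnorm_sum _ _ _) _.
  have t l : l != k -> hnorm (c l (u (w k)) *: u (e l)) <= d^-1 * h.
    move=> lk; rewrite hnormZ (hnorm_unit (x := u (e l))) ?mulr1; last first.
      by rewrite [LHS]oe eqxx.
    have := cle l (u (w k)); rewrite normcE (normcE (dot _ _)) -rmorphM lecR.
    by move=> /le_trans; apply; rewrite ler_wpM2l// wh// eq_sym.
  apply: le_trans (ler_sum _ t) _; rewrite sumr_const -[leLHS]mulr_natl.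
  by rewrite ler_wpM2r ?mulr_ge0// ler_nat; apply: leq_trans (max_card _) _; rewrite card_ord.
apply: le_trans (mnorm_le_sum _) _.
have E i j : vnorm (first_column r i j) <= n%:R * (d^-1 * h).
  by rewrite mxE; case: ifP => _ //; rewrite vnorm0 !mulr_ge0.
apply: le_trans (ler_sum _ (fun i _ => ler_sum _ (fun j _ => E i j))) _.
set M := n%:R * (d^-1 * h).
by rewrite !sumr_const !card_ord (mulr_natl M) (mulr_natl (M *+ n)).
Qed.

End Homogeneous.

(** * Finite subsets of a subspace of an ultrapower *)

(** Each strict inequality between norms in the ultrapower holds on a set of the
    ultrafilter; finitely many such sets have a common index. *)
Lemma ultrapower_finite_approx (R : realType) (X Z : opspace R) (I : Type) (U : set_system I)
    (FU : UltraFilter U) (j : {linear Z -> ultrapower X FU})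
    (J T : finType) (n : nat) (v : J -> Z) (c : T -> 'I_n -> J) (M t : R) :
  complete_isometry j ->
  (forall s, mnorm (first_column (v \o c s)) < M) ->
  (forall a b, a != b -> t < vnorm (v a - v b)) ->
  exists p : J -> X, (forall s, mnorm (first_column (p \o c s)) < M) /\
    (forall a b, a != b -> t < vnorm (p a - p b)).
Proof.
move=> ij vM vt; have PU : ProperFilter U by exact: (@ultra_proper _ _ FU).
pose x a : family X I := repr (j (v a)).
have piE a : \pi_(ultrapower X FU) (x a) = j (v a) by rewrite reprK.
pose P (k : I) (s : T) := mnorm (first_column (fun i => x (c s i) k)) < M.
pose Q (k : I) (ab : J * J) := ab.1 != ab.2 -> t < vnorm (x ab.1 k - x ab.2 k).
have UP s : \forall k \near U, P k s.
  pose F : 'M[family X I]_n := \matrix_(i, l) if l == 0%N :> nat then x (c s i) else 0.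
  have := @ultrapower_mnorm_cvg R I U FU X n (map_mx j (first_column (v \o c s))) F.
  rewrite ij => cv.
  have piF i l : \pi_(ultrapower X FU) (F i l) = map_mx j (first_column (v \o c s)) i l.
    by rewrite !mxE; case: ifP => _; rewrite ?piE// linear0 raddf0.
  apply: filterS (cvgr_lt _ (cv piF) _ (vM s)) => k.
  by rewrite /P; congr (mnorm _ < _); apply/matrixP => i l; rewrite !mxE; case: ifP.
have UQ ab : \forall k \near U, Q k ab.
  have [abE|abn] := eqVneq ab.1 ab.2; first by apply: filterE => k; rewrite /Q abE eqxx.
  pose F : 'M[family X I]_1 := const_mx (x ab.1 - x ab.2).
  have := @ultrapower_mnorm_cvg R I U FU X 1 (map_mx j (const_mx (v ab.1 - v ab.2))) F.
  rewrite ij => cv.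
  have piF i l : \pi_(ultrapower X FU) (F i l) = map_mx j (const_mx (v ab.1 - v ab.2)) i l.
    by rewrite !mxE raddfB linearB -!piE.
  apply: filterS (cvgr_gt _ (cv piF) _ (vt _ _ abn)) => k; rewrite /Q => h _.
  move: h; congr (_ < mnorm _).
  by apply/matrixP => i l; rewrite !mxE.
have UPQ : \forall k \near U, (forall s, P k s) /\ (forall ab, Q k ab).
  exact: filterI (filter_forall _ UP) (filter_forall _ UQ).
have [k [Pk Qk]] := @filter_ex _ _ PU _ UPQ; exists (fun a => x a k); split; first exact: Pk.
by move=> a b ab; exact: (Qk (a, b)).
Qed.

(** * Comparison of the two sequences kappa *)

Section Comparison.
Variable R : realType.

(** A supremum of an unbounded set of reals would be 0: boundedness by n^2 is what
    makes kappa an upper bound. *)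
Lemma kappa_ge (Z : opspace R) n (e : 'I_n -> Z) : orthonormal_in e ->
  mnorm (first_column e) <= kappa Z n.
Proof.
move=> oe; apply: ub_le_sup; last by exists e.
exists (n%:R * n%:R) => _ [e' [H [u [[_ iso] oe']]] <-].
have e1 k : vnorm (e' k) <= 1.
  by rewrite -iso hnorm_unit// oe' eqxx.
apply: le_trans (mnorm_le_sum _) _.
have E i j : vnorm (first_column e' i j) <= 1 by rewrite mxE; case: ifP => _ //; rewrite vnorm0.
apply: le_trans (ler_sum _ (fun i _ => ler_sum _ (fun j _ => E i j))) _.
by rewrite !sumr_const !card_ord mulr_natr.
Qed.

(** The convention is sup = 0 for an empty or unbounded set, so a positive value
    of kappa is a genuine supremum. *)
Lemma kappa_witness (Y : opspace R) n (a : R) : 0 < a < kappa Y n ->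
  exists2 e : 'I_n -> Y, orthonormal_in e & a < mnorm (first_column e).
Proof.
move=> /andP[a0 ak].
set S := [set mnorm (first_column e) | e in [set e : 'I_n -> Y | orthonormal_in e]].
have hS : has_sup S.
  by apply: contrapT => /sup_out S0; move: (lt_trans a0 ak); rewrite /kappa -/S S0 ltxx.
have ka0 : 0 < kappa Y n - a by rewrite subr_gt0.
have [_ [e oe <-] h] := sup_adherent ka0 hS.
by exists e => //; move: h; rewrite /kappa -/S; lra.
Qed.

Lemma vnorm_const (V : matrixNormedType R) (x : V) : mnorm (const_mx x : 'M[V]_1) = vnorm x.
Proof. by []. Qed.

Section Embedding.
Variables (X Y : opspace R) (f : unit_ball X -> Y) (L : R).

Definition small_scale_lipschitz := forall n (x y : 'M[unit_ball X]_n),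
  mnorm (map_mx sval x) <= 1 -> mnorm (map_mx sval y) <= 1 ->
  L^-1 * mnorm (map_mx sval x - map_mx sval y)
    <= mnorm (map_mx f x - map_mx f y)
    <= L * mnorm (map_mx sval x - map_mx sval y).

Hypothesis fL : small_scale_lipschitz.

Lemma embedding_dist (x y : unit_ball X) :
  L^-1 * vnorm (sval x - sval y) <= vnorm (f x - f y) <= L * vnorm (sval x - sval y).
Proof.
have E (x' : unit_ball X) : map_mx sval (const_mx x' : 'M[_]_1) = const_mx (sval x').
  by apply/matrixP => i j; rewrite !mxE.
have := @fL 1 (const_mx x) (const_mx y).
rewrite !E !vnorm_const => /(_ (svalP x) (svalP y)).
have -> : const_mx (sval x) - const_mx (sval y) = const_mx (sval x - sval y) :> 'M[X]_1.
  by apply/matrixP => i j; rewrite !mxE.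
have -> // : map_mx f (const_mx x) - map_mx f (const_mx y) = const_mx (f x - f y) :> 'M[Y]_1.
by apply/matrixP => i j; rewrite !mxE.
Qed.

(** Outside the first column both matrices have entries 0, so their images agree
    there, even if f does not vanish at 0. *)
Lemma embedding_column n (x y : 'I_n -> unit_ball X) :
  mnorm (first_column (sval \o x)) <= 1 -> mnorm (first_column (sval \o y)) <= 1 ->
  mnorm (first_column (fun k => f (x k) - f (y k))) <=
    L * mnorm (first_column (fun k => sval (x k) - sval (y k))).
Proof.
have z1 : vnorm (0 : X) <= 1 by rewrite vnorm0.
pose C (x : 'I_n -> unit_ball X) : 'M[unit_ball X]_n :=
  \matrix_(i, j) if j == 0%N :> nat then x i else exist _ 0 z1.
have E (x' : 'I_n -> unit_ball X) : map_mx sval (C x') = first_column (sval \o x').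
  by apply/matrixP => i j; rewrite !mxE; case: ifP.
move=> x1 y1; have := @fL n (C x) (C y); rewrite !E => /(_ x1 y1) /andP[_].
have -> : first_column (sval \o x) - first_column (sval \o y) =
    first_column (fun k => sval (x k) - sval (y k)).
  by apply/matrixP => i j; rewrite !mxE; case: ifP => // _; rewrite subrr.
have -> // : map_mx f (C x) - map_mx f (C y) = first_column (fun k => f (x k) - f (y k)).
by apply/matrixP => i j; rewrite !mxE; case: ifP => // _; rewrite subrr.
Qed.

End Embedding.

(** Put t = 1/(2k').  In Z take an orthonormal system of n blocks of m vectors,
    scaled by t: a column with one vector from each block has norm at most
    t kappa_n(Z) < 1/2, and distinct vectors are at distance more than t.
    Approximate it by points p of X, apply f, and select two points in each block
    whose images have almost orthogonal differences w_k.  The column of the w_k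
    has norm at most L, since those of the p have norm at most 1/2, whereas each
    w_k has norm at least t/L, so that homogeneity of Y bounds from below the
    norm of the same column by about t a / L.  Comparing the two gives the
    bound, the constant 8 absorbing the errors. *)
Lemma kappa_embedding (X Z Y : opspace R) (f : unit_ball X -> Y) (L : R) n (a k' : R) :
  dvoretzky_space X Z -> homogeneous Y -> 1 <= L ->
  small_scale_lipschitz f L ->
  (0 < n)%N -> 0 < a < kappa Y n -> kappa Z n < k' -> 0 < k' -> a <= 8 * L ^+ 2 * k'.
Proof.
move=> [infZ _ [HZ [uZ [buZ isoZ]]] [I [U [FU [j ij]]]]] homY L1 fL n0.
move=> /[dup] ak /andP[a0 _] kk' k'0.
have L0 : 0 < L by apply: lt_le_trans L1.
have [e [H [u [isou oe]]] ae] := kappa_witness ak.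
have [bu iso] := isou.
pose t := (2 * k')^-1; have t0 : 0 < t by rewrite invr_gt0 mulr_gt0.
pose d := t / L; have d0 : 0 < d by rewrite divr_gt0.
pose N : R := n%:R; have N0 : 0 < N by rewrite ltr0n.
(* The first bound is for the selection of pairs; the second makes the error in
   homogeneous_column at most a / 2. *)
pose eps := Num.min (d / (4 * N)) (a * d / (8 * N ^+ 3)).
have eps0 : 0 < eps by rewrite lt_min; apply/andP; split; rewrite divr_gt0// mulr_gt0// exprn_gt0.
have eps1 : n%:R * (2 * eps) <= d / 2.
  have : eps <= d / (4 * N) by rewrite /eps ge_min lexx.
  rewrite ler_pdivlMr ?mulr_gt0// -/N; lra.
have [m0 hm] := almost_orthogonal_pairs H L d0 eps0 eps1.
pose m := m0.+1.
have [v0 ov0] := infinite_orthonormal_fin ('I_n * 'I_m)%type buZ infZ.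
pose v ka := t%:C *: v0 ka.
pose c (s : {ffun 'I_n -> 'I_m}) (k : 'I_n) := (k, s k).
have vnormZ0 (z : Z) : vnorm (t%:C *: z) = t * vnorm z.
  by rewrite -!isoZ linearZ hnormZ_real// ltW.
have vM s : mnorm (first_column (v \o c s)) < 1 / 2.
  have -> : first_column (v \o c s) = map_mx ( *:%R t%:C) (first_column (v0 \o c s)).
    by apply/matrixP => i l; rewrite !mxE; case: ifP => // _; rewrite scaler0.
  apply: le_lt_trans (mnormZ _ (ltW t0)) _.
  have : mnorm (first_column (v0 \o c s)) <= kappa Z n.
    apply: kappa_ge; exists HZ, uZ; split=> // i l; have := ov0 (c s i) (c s l).
    rewrite /= => ->; congr (_%:R); rewrite /c xpair_eqE.
    by case: eqP => // ->; rewrite eqxx.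
  move=> /le_lt_trans/(_ kk') h; rewrite ltr_pdivlMr// mulrC.
  by rewrite mulrCA mulrC /t ltr_pdivrMr ?mulr_gt0// mul1r ltr_pM2l.
have vt x y : x != y -> t < vnorm (v x - v y).
  move=> xy; rewrite -scalerBr vnormZ0 ltr_pMr// -isoZ linearB.
  have h2 : hnorm (uZ (v0 x) - uZ (v0 y)) ^+ 2 = 2.
    apply: complexI; rewrite rmorphXn /= -hnormE [RHS]rmorphMn rmorph1 sqr_norm_dot dotDl !dotDr.
    have dN z z' : dot z (- z') = - dot z z' :> R[i] by rewrite -scaleN1r dotZr rmorphN1 mulN1r.
    have dN' z z' : dot (- z) z' = - dot z z' :> R[i] by rewrite -scaleN1r dotZl mulN1r.
    rewrite dN' !dN dN'.
    have /= -> := ov0 x x; have /= -> := ov0 y y; have /= -> := ov0 x y; have /= -> := ov0 y x.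
    by rewrite !eqxx [y == x]eq_sym (negPf xy) oppr0 addr0 add0r opprK.
  by rewrite -(@ltr_pXn2r _ 2) ?nnegrE ?hnorm_ge0// expr1n h2; lra.
have [p [pM pt]] := ultrapower_finite_approx ij vM vt.
have p1 ka : vnorm (p ka) <= 1.
  have := vnorm_le_mnorm (first_column (p \o c [ffun=> ka.2])) ka.1 (Ordinal n0).
  rewrite mxE /= /c ffunE -surjective_pairing => /le_trans; apply.
  by apply: le_trans (ltW (pM _)) _; lra.
have z1 : vnorm (0 : X) <= 1 by rewrite vnorm0.
pose q ka : unit_ball X := exist _ (p ka) (p1 ka).
pose q0 : unit_ball X := exist _ 0 z1.
pose z (k : 'I_n) (b : 'I_m) := u (f (q (k, b)) - f q0).
have zE k b b' : z k b - z k b' = u (f (q (k, b)) - f (q (k, b'))).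
  by rewrite /z -linearB opprB addrA subrK.
have zB k b : hnorm (z k b) <= L.
  rewrite /z iso; have /andP[_] := embedding_dist fL (q (k, b)) q0.
  move=> /le_trans; apply; rewrite ger_pMr// subr0; exact: p1.
have zd k b b' : b != b' -> d <= hnorm (z k b - z k b').
  move=> bb'; rewrite zE iso; have /andP[h _] := embedding_dist fL (q (k, b)) (q (k, b')).
  apply: le_trans h; rewrite /d mulrC ler_pM2l ?invr_gt0//; apply/ltW/pt.
  by rewrite xpair_eqE eqxx.
have [s [s' [g [og gd gh]]]] := hm m (ltnSn _) z zB zd.
pose w k := f (q (k, s k)) - f (q (k, s' k)).
have wL : mnorm (first_column w) <= L.
  have sE (r : 'I_n -> 'I_m) : mnorm (first_column (sval \o (fun k => q (k, r k)))) <= 1 / 2.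
    have := ltW (pM [ffun k => r k]); congr (mnorm _ <= _).
    by apply/matrixP => i l; rewrite !mxE /= /c ffunE.
  have h1 : 1 / 2 <= 1 :> R by lra.
  apply: le_trans (embedding_column fL (le_trans (sE s) h1) (le_trans (sE s') h1)) _.
  rewrite ger_pMr//.
  have -> : first_column (fun k => sval (q (k, s k)) - sval (q (k, s' k))) =
    first_column (sval \o (fun k => q (k, s k))) - first_column (sval \o (fun k => q (k, s' k))).
    by apply/matrixP => i l; rewrite !mxE; case: ifP => // _; rewrite subrr.
  apply: le_trans (mnormB _ _) _; apply: le_trans (lerD (sE s) (sE s')) _; lra.
have d20 : 0 < d / 2 by rewrite divr_gt0.
have e20 : 0 <= 2 * eps by rewrite mulr_ge0// ltW.
have wd k : d / 2 <= complex.Re `|dot (u (w k)) (g k)| by have := gd k; rewrite zE.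
have wh k l : k != l -> complex.Re `|dot (u (w k)) (g l)| <= 2 * eps.
  by move=> kl; have := gh k l kl; rewrite zE.
have := lt_le_trans ae (homogeneous_column homY isou oe og d20 e20 wd wh).
have -> : (d / 2)^-1 = 4 * L * k' by rewrite /d /t; field; rewrite !gt_eqF.
have eps2 : eps <= a * d / (8 * N ^+ 3) by rewrite /eps ge_min lexx orbT.
have E3 : N * (N * (N * (4 * L * k' * (2 * eps)))) <= a / 2.
  have -> : N * (N * (N * (4 * L * k' * (2 * eps)))) = (8 * L * k' * N ^+ 3) * eps by ring.
  apply: le_trans (ler_wpM2l _ eps2) _; first by rewrite !mulr_ge0 ?exprn_ge0// ltW.
  by rewrite le_eqVlt; apply/orP; left; apply/eqP; rewrite /d /t; field; rewrite !gt_eqF.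
have E1 : 4 * L * k' * mnorm (first_column w) <= 4 * L * k' * L.
  by rewrite ler_wpM2l// !mulr_ge0// ltW.
rewrite -/N => h.
have : a <= 2 * (4 * L * k' * L) by lra.
by rewrite (_ : 2 * (4 * L * k' * L) = 8 * L ^+ 2 * k'); last ring.
Qed.

End Comparison.

Theorem corollary1p9 (R : realType) (X Z Y : opspace R) (c : R)
  (hX : infinite_dimensional X)
  (hZ : dvoretzky_space X Z)
  (hYhom : homogeneous Y) (hYhilb : hilbertian Y)
  (hYdim : infinite_dimensional Y)
  (hc : 0 <= c <= 1 / 2)
  (hkappa : dominates (kappa Y) (fun n => n%:R `^ c))
  (hf : exists f : unit_ball X -> Y, small_scale_embedding f) :
  dominates (kappa Z) (fun n => n%:R `^ (c / (1 + 2 * c))).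
Proof.
have [K K0 hK] := hkappa; have [f [L L1 fL]] := hf.
have L0 : 0 < L by apply: lt_le_trans L1.
have /andP[c0 _] := hc.
have KL0 : 0 < K / (16 * L ^+ 2) by rewrite divr_gt0// mulr_gt0// exprn_gt0.
exists (K / (16 * L ^+ 2)) => // n n0.
have n1 : 1 <= n%:R :> R by rewrite ler1n.
apply: (@le_trans _ _ (K / (16 * L ^+ 2) * n%:R `^ c)).
  rewrite ler_wpM2l ?(ltW KL0)//; apply: ler_powR => //.
  rewrite ler_pdivrMr; last by lra.
  by rewrite mulrDr mulr1 lerDl mulr_ge0//; lra.
have P0 : 0 < n%:R `^ c by apply: powR_gt0; apply: lt_le_trans n1.
have k0 : 0 <= kappa Z n.
  have [infZ _ [HZ [uZ [buZ isoZ]]] _] := hZ.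
  have [v ov] := infinite_orthonormal n buZ infZ.
  apply: le_trans (mnorm_ge0 (first_column v)) (kappa_ge _).
  by exists HZ, uZ; split.
apply/ler_addgt0Pr => e e0.
have aK : 0 < K / 2 * n%:R `^ c < kappa Y n.
  rewrite mulr_gt0 ?divr_gt0//=; apply: lt_le_trans (hK n n0).
  by rewrite ltr_pM2r//; lra.
have h := @kappa_embedding R X Z Y f L n _ (kappa Z n + e) hZ hYhom L1 fL n0 aK.
rewrite mulrAC ler_pdivrMr ?mulr_gt0 ?exprn_gt0//.
have k1 : kappa Z n < kappa Z n + e by rewrite ltrDl.
have := h k1 (le_lt_trans k0 k1); lra.
Qed.
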